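(* Let $K$ be a field of characteristic zero and let $n\ge1$, $d\ge0$ be integers. A basis for the $K$-vector space of balancings over $K$ on the complete $d$-complex $\Delta_{n,d}$ on $n$ vertices is given by all balanced complexes of the form $\prod_{j=2}^{n}\{\{1\},\{j\}\}^{k_j}$, where each $k_j\in\mathbb{Z}_{\ge0}$ and $\sum_{j=2}^n k_j=d+1$, with the product balancing induced by balancing each $\{\{1\},\{j\}\}$ with weights $w(\{1\})=1$, $w(\{j\})=-1$.
   Context: A $d$-simplex on $\{1,\ldots,n\}$ is a multiset of cardinality $d+1$ with elements in $\{1,\ldots,n\}$; a $d$-complex is a set of $d$-simplices. The complete $d$-complex $\Delta_{n,d}$ is the set of all $d$-simplices on $\{1,\ldots,n\}$. $m(i\in S)$ is the multiplicity of $i$ in the multiset $S$, and $m(T\subseteq S)=\prod_{i}\binom{m(i\in S)}{m(i\in T)}$ (zero if $T\not\subseteq S$). A balancing over $K$ on a $d$-complex $\Delta$ is a function $w:\Delta\to K$ (zero values allowed) such that $\sum_{S\subseteq\sigma\in\Delta}w(\sigma)\,m(S\subseteq\sigma)=0$ for every multiset $S$ on $\{1,\ldots,n\}$ with $0\le|S|\le d$. A balancing on a subcomplex of $\Delta_{n,d}$ is regarded as a balancing of $\Delta_{n,d}$ by extending it by zero. With $\uplus$ denoting multiset sum (multiplicities add), the product of a $d_1$-complex $\Delta_1$ and a $d_2$-complex $\Delta_2$ is the $(d_1+d_2+1)$-complex $\Delta_1\cdot\Delta_2=\{\sigma_1\uplus\sigma_2 : \sigma_1\in\Delta_1,\sigma_2\in\Delta_2\}$.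 If $w_1,w_2$ are balancings on $\Delta_1,\Delta_2$, the product balancing is $w(\sigma)=\sum w_1(\sigma_1)w_2(\sigma_2)$, the sum over all pairs $(\sigma_1,\sigma_2)\in\Delta_1\times\Delta_2$ with $\sigma_1\uplus\sigma_2=\sigma$. Products of several factors and powers are iterated products; a factor with exponent $0$ is omitted. *)

(* Defs.v *)
(* Mathematical Components, with finite sets and multisets from finmap. *)
From HB Require Import structures.
From mathcomp Require Import all_boot all_order all_algebra.
From mathcomp Require Export finmap multiset.

Set Implicit Arguments.
Unset Strict Implicit.
Unset Printing Implicit Defensive.

Import GRing.Theory.

(* The vertices 1, ..., n are the elements of 'I_n.  The cardinality of a
   multiset S : {mset 'I_n}, counted with multiplicity, is size S, and the
   multiplicity of i in S is S i. *)

Section Complexes.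

Local Open Scope mset_scope.
Local Open Scope fset_scope.
Local Open Scope nat_scope.

(* All multisets of cardinality k, as the set of multisets underlying the
   k-tuples of vertices; see multisetsP. *)
Definition multisets (n k : nat) : {fset {mset 'I_n}} :=
  [fset seq_mset (val t) | t in {: k.-tuple 'I_n}].

Lemma multisetsP (n k : nat) (S : {mset 'I_n}) :
  (S \in multisets n k) = (size S == k).
Proof.
apply/imfsetP/idP => [[t _ ->]|hS].
  by rewrite (perm_size (perm_eq_seq_mset _)) size_tuple.
by exists (Tuple hS) => //=; rewrite seq_mset_id.
Qed.

Definition complete_complex (n d : nat) : {fset {mset 'I_n}} :=
  multisets n d.+1.

Definition submult (n : nat) (T S : {mset 'I_n}) : nat :=
  \prod_(i < n) 'C(S i, T i).

Lemma submult_eq0 (n : nat) (T S : {mset 'I_n}) :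
  (submult T S == 0) = ~~ (T `<=` S)%mset.
Proof.
rewrite /submult; apply/idP/idP => [/eqP h0|hn].
  apply/negP => /msubsetP hTS; move/eqP: h0; apply/negP.
  by rewrite -lt0n prodn_gt0 // => i; rewrite bin_gt0.
have /existsP[i hi] : [exists i, ~~ (T i <= S i)].
  by rewrite -negb_forall; apply: contra hn => /forallP h; apply/msubsetP.
by rewrite (bigD1 i) //= bin_small ?mul0n // ltnNge.
Qed.

Definition complex_prod (n : nat) (D1 D2 : {fset {mset 'I_n}}) :
    {fset {mset 'I_n}} :=
  [fset (s1 `+` s2)%mset | s1 in D1, s2 in D2].

End Complexes.

Section Balancings.

Local Open Scope mset_scope.
Local Open Scope fset_scope.
Local Open Scope ring_scope.

Variables (K : fieldType) (n : nat).

(* K is viewed as a vector space over itself, so that {ffun D -> K^o} is the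
   K-vector space of functions on the finite set D. *)

Definition face_sum (D : {fset {mset 'I_n}}) (S : {mset 'I_n})
    (w : {ffun D -> K^o}) : K^o :=
  \sum_(s : D | (S `<=` val s)%mset) w s * (submult S (val s))%:R.

Definition is_balancing (d : nat) (D : {fset {mset 'I_n}})
    (w : {ffun D -> K^o}) : Prop :=
  forall S : {mset 'I_n}, (size S <= d)%N -> face_sum S w = 0.

Lemma face_sum_is_linear (D : {fset {mset 'I_n}}) (S : {mset 'I_n}) :
  linear (@face_sum D S).
Proof.
move=> a u v; rewrite /face_sum scaler_sumr -big_split /=.
by apply: eq_bigr => s _; rewrite !ffunE mulrDl scalerAl.
Qed.

HB.instance Definition _ (D : {fset {mset 'I_n}}) (S : {mset 'I_n}) :=
  GRing.isLinear.Build K {ffun D -> K^o} K^o *:%R (@face_sum D S)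
    (@face_sum_is_linear D S).

(* The subspace of balancings, see balancingsP. *)
Definition balancings (d : nat) (D : {fset {mset 'I_n}}) :
    {vspace {ffun D -> K^o}} :=
  (\bigcap_(e < d.+1) \bigcap_(S : multisets n e)
     lker (linfun (@face_sum D (val S))))%VS.

Lemma balancingsP (d : nat) (D : {fset {mset 'I_n}}) (w : {ffun D -> K^o}) :
  w \in balancings d D <-> is_balancing d w.
Proof.
rewrite memvE; split.
  move=> /subv_bigcapP hw S hS.
  have /subv_bigcapP hw' := hw (Ordinal (hS : (size S < d.+1)%N)) isT.
  have hSm : S \in multisets n (size S) by rewrite multisetsP.
  have := hw' [` hSm] isT.
  by rewrite -memvE memv_ker lfunE /= => /eqP.
move=> hw; apply/subv_bigcapP => e _; apply/subv_bigcapP => S _.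
rewrite -memvE memv_ker lfunE /= hw //.
by have := valP S; rewrite multisetsP => /eqP ->; rewrite -ltnS.
Qed.

Record wcomplex := WComplex {
  simplices : {fset {mset 'I_n}};
  weight : {ffun simplices -> K}
}.

Definition wprod (W1 W2 : wcomplex) : wcomplex :=
  @WComplex (complex_prod (simplices W1) (simplices W2))
    [ffun s => \sum_(p : simplices W1 * simplices W2 |
                     (val p.1 `+` val p.2)%mset == val s)
                 weight W1 p.1 * weight W2 p.2].

(* The empty product: the empty simplex with weight 1.  It is neutral for
   wprod (see wfun_wprod1, wfun_wprod1l), so it only serves to omit factors
   with exponent 0. *)
Definition wone : wcomplex :=
  @WComplex [fset mset0] [ffun => 1].

Definition wpow (W : wcomplex) (k : nat) : wcomplex := iterop k wprod W wone.

(* The weight function of W extended by zero to all multisets. *)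
Definition wfun (W : wcomplex) (s : {mset 'I_n}) : K :=
  if insub s is Some t then weight W t else 0.

Definition wext (D : {fset {mset 'I_n}}) (W : wcomplex) : {ffun D -> K^o} :=
  [ffun s => wfun W (val s)].

Lemma wfun_wprod (W1 W2 : wcomplex) (s : {mset 'I_n}) :
  wfun (wprod W1 W2) s =
    \sum_(p : simplices W1 * simplices W2 | (val p.1 `+` val p.2)%mset == s)
      weight W1 p.1 * weight W2 p.2.
Proof.
rewrite /wfun; case: insubP => [u _ <-|hs]; first by rewrite ffunE.
rewrite big_pred0 // => -[a b] /=; apply: contraNF hs => /eqP <-.
by apply/imfset2P; exists (val a); [exact: valP | exists (val b); [exact: valP|]].
Qed.

Lemma wfunE (W : wcomplex) (s : {mset 'I_n}) :
  wfun W s = \sum_(a : simplices W | val a == s) weight W a.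
Proof.
rewrite /wfun; case: insubP => [u _ <-|hs].
  transitivity (\sum_(a | a == u) weight W a).
    by rewrite big_pred1_eq.
  by apply: eq_bigl => a; rewrite (inj_eq val_inj).
rewrite big_pred0 // => a; apply: contraNF hs => /eqP <-; exact: valP.
Qed.

Lemma wfun_wprod1 (W : wcomplex) : wfun (wprod W wone) =1 wfun W.
Proof.
move=> s; rewrite wfun_wprod wfunE big_mkcond [RHS]big_mkcond /=.
rewrite -(pair_bigA _ (fun a b => if (val a `+` val b)%mset == s
            then weight W a * weight wone b else 0)) /=.
by apply: eq_bigr => a _; rewrite big_fset1 /= msetD0 ffunE mulr1.
Qed.

Lemma wfun_wprod1l (W : wcomplex) : wfun (wprod wone W) =1 wfun W.
Proof.
move=> s; rewrite wfun_wprod wfunE big_mkcond [RHS]big_mkcond /=.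
rewrite -(pair_bigA _ (fun b a => if (val b `+` val a)%mset == s
            then weight wone b * weight W a else 0)) /= big_fset1 /=.
by apply: eq_bigr => a _; rewrite mset0D ffunE mul1r.
Qed.

(* {{i},{j}} with weight 1 on {i} and -1 on {j}; only meaningful for i != j. *)
Definition wpair (i j : 'I_n) : wcomplex :=
  @WComplex [fset [mset i]; [mset j]]
    [ffun s => if val s == [mset i]%mset then 1 else -1].

End Balancings.

Arguments wone {K n}.
Arguments wpair K {n}.

Section ProductBasis.

Local Open Scope mset_scope.
Local Open Scope fset_scope.
Local Open Scope ring_scope.

Variables (K : fieldType) (n d : nat) (v1 : 'I_n).

(* An exponent vector (k_j), j ranging over the vertices other than v1.  As
   the k_j are to sum to d + 1, each is at most d + 1; the bound makes the
   type of exponent vectors finite. *)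
Definition exponents := {ffun {j : 'I_n | j != v1} -> 'I_d.+2}.

Definition pair_prod (k : exponents) : wcomplex K n :=
  \big[@wprod K n / wone]_(j : {j : 'I_n | j != v1})
     wpow (wpair K v1 (val j)) (k j).

Lemma pair_prod_sub (k : exponents) :
  (\sum_j (k j : nat) = d.+1)%N ->
  simplices (pair_prod k) `<=` complete_complex n d.
Proof.
move=> hk; apply/fsubsetP => s hs; rewrite multisetsP -hk.
pose hom (W : wcomplex K n) m :=
  forall s : {mset 'I_n}, s \in simplices W -> size s = m.
have hom1 : hom wone 0 by move=> t; rewrite inE => /eqP ->; rewrite enum_mset0.
have homM W1 W2 m1 m2 : hom W1 m1 -> hom W2 m2 -> hom (wprod W1 W2) (m1 + m2)%N.
  move=> h1 h2 _ /imfset2P[a /= /h1 <-] [b /= /h2 <-] ->.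
  rewrite -size_cat; apply: perm_size; apply/allP => x _ /=.
  by rewrite count_cat !count_mem_mset msetE2.
have homX W m : hom W 1 -> hom (wpow W m) m.
  rewrite /wpow; case: m => // m hW; rewrite iteropS.
  by elim: m => //= m IH; apply: (homM _ _ 1%N).
suff: hom (pair_prod k) (\sum_j (k j : nat))%N.
  by move=> h; apply/eqP/h.
rewrite /pair_prod; elim/big_rec2: _ => // j W m _ IH.
apply: homM IH; apply: homX.
by move=> t /fset2P[] ->; rewrite enum_msetn.
Qed.

Definition pair_prod_balancing (k : exponents) :
    {ffun complete_complex n d -> K^o} :=
  wext (complete_complex n d) (pair_prod k).

Definition product_balancings : seq {ffun complete_complex n d -> K^o} :=
  [seq pair_prod_balancing k
     | k : exponents <- enum {: exponents} & (\sum_j (k j : nat) == d.+1)%N].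

End ProductBasis.

(* Main.v *)
From HB Require Import structures.
Require Import Defs.
From mathcomp Require Import all_boot all_order all_algebra.

(** Fix the apex v = vertex 1.  The idea is to find coordinates on the space of
    balancings: the values of a balancing on the simplices that avoid v.  Such
    a simplex of cardinality d + 1 is the multiset with multiplicities k_j for
    exactly one exponent vector k of total d + 1 ([exponent_mset]).

    These coordinates are separating ([balancing_eq0]): if s contains v, the
    balancing condition at the face s minus v expresses a nonzero integer
    multiple of the weight of s through the weights of simplices with fewer
    copies of v, so in characteristic zero a balancing that vanishes on all
    simplices avoiding v vanishes.

    They are dual, up to the global sign (-1)^(d+1), to the family of products
    ([wfun_pair_prod]): when the product of the [{v} - {j}]^k_j is expanded,
    the only term avoiding v takes -{j} from each factor.

    Finally the products are balancings ([pair_prod_balancing_mem]).  Read a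
    weighted complex as the linear functional g |-> [wsum W g] on functions of
    multisets; products then become convolutions.  The functional of
    {v} - {j} is a difference operator, which lowers degree by one, so a
    product of d + 1 of them kills every function of degree at most d.  By
    Pascal's rule, a |-> m(S in a) has degree at most |S| ([deg_lt_submult]).

    A family in U with a separating dual family of functionals on U is a basis
    of U ([basis_of_dual]). *)

Set Implicit Arguments.
Unset Strict Implicit.
Unset Printing Implicit Defensive.

Import GRing.Theory.

Local Open Scope ring_scope.

(** * Bases from dual functionals *)

Section DualBasis.

Variables (K : fieldType) (V : vectType K) (I : eqType).

(** The dual functionals give both halves: applied to a relation they isolate
    each coefficient, and u minus the combination with coefficients
    phi i u / c is killed by all of them, hence zero. *)
Lemma basis_of_dual (U : {vspace V}) (s : seq I) (v : I -> V)
    (phi : I -> {linear V -> K^o}) (c : K) :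
  c != 0 -> uniq s ->
  {in s &, forall i j, phi i (v j) = if i == j then c else 0} ->
  {in s, forall i, v i \in U} ->
  (forall u, u \in U -> {in s, forall i, phi i u = 0} -> u = 0) ->
  basis_of U [seq v i | i <- s].
Proof.
move=> c0 us dual vU sep; have free_s : free [seq v i | i <- s].
  elim: s us dual {vU sep} => [|i s IH] /=; first by rewrite nil_free.
  case/andP=> his us dual; rewrite free_cons IH // ?andbT; last first.
    by move=> k l hk hl; apply: dual; rewrite inE ?hk ?hl orbT.
  apply/negP => vi_span; case/negP: c0.
  have <- : phi i (v i) = c by rewrite dual ?mem_head // eqxx.
  have /subvP/(_ _ vi_span) : (<<[seq v k | k <- s]>> <= lker (linfun (phi i)))%VS.
    apply/span_subvP => _ /mapP[k hk ->].
    have ik : i != k by apply: contraNneq his => ->.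
    by rewrite memv_ker lfunE /= dual ?mem_head ?inE ?hk ?orbT // (negPf ik).
  by rewrite memv_ker lfunE.
have vsU : (<<[seq v i | i <- s]>> <= U)%VS.
  by apply/span_subvP => _ /mapP[i hi ->]; apply: vU.
rewrite basisEfree free_s vsU /=; apply: leq_trans (dim_span _).
apply: dimvS; apply/subvP => u uU.
pose u' := \sum_(j <- s) (c^-1 * phi j u) *: v j.
have u's : u' \in <<[seq v i | i <- s]>>%VS.
  rewrite /u' big_seq; apply: memv_suml => j hj.
  by apply: memvZ; apply: memv_span; apply: map_f.
suff /eqP : u - u' = 0 by rewrite subr_eq0 => /eqP ->.
apply: sep => [|i hi]; first by rewrite memvB // (subvP vsU).
rewrite linearB linear_sum /= (bigD1_seq i) //= linearZ /= dual // eqxx.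
rewrite big_seq_cond big1 ?addr0 => [|j /andP[hj hji]].
  by rewrite [_ *: _]mulrAC mulVf // mul1r subrr.
by rewrite linearZ /= dual // eq_sym (negPf hji) scaler0.
Qed.

End DualBasis.

(** * Cardinalities and submultiset counts *)

Section Multisets.

Local Open Scope mset_scope.
Local Open Scope nat_scope.

Variable n : nat.
Implicit Types (a b s S T : {mset 'I_n}) (i j : 'I_n).

Lemma size_msetE s : size s = \sum_(i < n) s i.
Proof.
under eq_bigr do rewrite -count_mem_mset.
elim: (s : seq _) => [|x r IH] /=; first by rewrite big1.
by rewrite big_split /= -IH (bigD1 x) //= eqxx big1 // => i; rewrite eq_sym => /negPf ->.
Qed.

Lemma size_msetD a b : size (a `+` b) = size a + size b.
Proof.
by rewrite !size_msetE -big_split; apply: eq_bigr => i _; rewrite msetE2.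
Qed.

Lemma msubset_size_eq S T : S `<=` T -> size S = size T -> S = T.
Proof.
move=> sST eST; have := msetBDK sST.
move/(congr1 (fun s => size s)); rewrite size_msetD eST.
move/eqP; rewrite -[X in _ == X]add0n eqn_add2r size_mset_eq0 => /eqP d0.
by rewrite -[T](msetBDK sST) d0 mset0D.
Qed.

(** Choosing a copy of S in i +` a either leaves out the new i or uses it, and
    then the rest is a copy of S minus i in a. *)
Lemma submult_pascal S a i :
  submult S (i +` a) = submult S a + (i \in S) * submult (S `\ i) a.
Proof.
rewrite /submult !(bigD1 i (P := predT)) //= mset1DE eqxx add1n.
have step T : \prod_(j < n | j != i) 'C((i +` a) j, T j)
     = \prod_(j < n | j != i) 'C(a j, T j).
  by apply: eq_bigr => j /negPf hj; rewrite mset1DE hj.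
have -> : \prod_(j < n | j != i) 'C(a j, (S `\ i) j)
     = \prod_(j < n | j != i) 'C(a j, S j).
  by apply: eq_bigr => j /negPf hj; rewrite msetB1E hj subn0.
rewrite step msetB1E eqxx -mset_gt0.
case: (S i) => [|m]; first by rewrite !bin0 mul0n addn0.
by rewrite mul1n subn1 /= binS mulnDl.
Qed.

End Multisets.

(** * Weighted complexes as functionals *)

Section Pairing.

Local Open Scope mset_scope.

Variables (K : fieldType) (n : nat).
Implicit Types (W : wcomplex K n) (g : {mset 'I_n} -> K).
Implicit Types (a b c s S : {mset 'I_n}) (i j : 'I_n).

(** The functional attached to W.  It gives access to both quantities of
    interest, the weights ([wfun_wsum]) and the face sums ([face_sum_wext]),
    and turns products of complexes into iterated functionals. *)
Definition wsum W g : K := \sum_(a : simplices W) weight W a * g (val a).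

Lemma eq_wsum W g h : g =1 h -> wsum W g = wsum W h.
Proof. by move=> gh; apply: eq_bigr => a _; rewrite gh. Qed.

Lemma wsum_wone g : wsum wone g = g mset0.
Proof. by rewrite /wsum big_fset1 /= ffunE mul1r. Qed.

Lemma wsum_wpair i j g : i != j ->
  wsum (wpair K i j) g = g [mset i] - g [mset j].
Proof.
move=> ij; have mij : [mset i] != [mset j].
  by apply: contra ij => /eqP ijE; rewrite -in_mset1 -ijE mset11.
rewrite /wsum.
under eq_bigr do rewrite ffunE.
rewrite -(big_seq_fsetE _ _ predT (fun s => (if s == [mset i] then 1 else -1) * g s)).
rewrite big_fsetU1; last by rewrite in_fset1.
rewrite (@big_seq_fset1 _ _ _ _ [mset j]) /= eqxx mul1r.
by rewrite eq_sym (negPf mij) mulN1r.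
Qed.

Lemma wsum_wprod W1 W2 g :
  wsum (wprod W1 W2) g = wsum W1 (fun a => wsum W2 (fun b => g (a `+` b))).
Proof.
(* Group the pairs of simplices by their sum. *)
have mem (p : simplices W1 * simplices W2) :
    val p.1 `+` val p.2 \in complex_prod (simplices W1) (simplices W2).
  by apply/imfset2P; exists (val p.1); [exact: valP|exists (val p.2); [exact: valP|]].
rewrite /wsum; under eq_bigr do rewrite ffunE mulr_suml.
under [RHS]eq_bigr do rewrite mulr_sumr.
rewrite pair_big /= (partition_big (fun p => [` mem p]%fset) predT) //=.
apply: eq_bigr => s _; apply: eq_big => [p|p /eqP <-]; last by rewrite mulrA.
by rewrite -(inj_eq val_inj).
Qed.

Lemma wfun_wsum W s : wfun W s = wsum W (fun a => (a == s)%:R).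
Proof.
rewrite wfunE big_mkcond; apply: eq_bigr => a _.
by case: eqP; rewrite ?mulr1 ?mulr0.
Qed.

Lemma face_sum_wext (D : {fset {mset 'I_n}}) W S :
  (simplices W `<=` D)%fset ->
  face_sum S (wext D W) = wsum W (fun a => (submult S a)%:R).
Proof.
move=> /fsubsetP sWD.
rewrite /face_sum big_mkcond /=.
rewrite /wsum (partition_big (fun a : simplices W => [` sWD _ (fsvalP a)]%fset) predT) //=.
apply: eq_bigr => s _; rewrite ffunE wfunE mulr_suml.
(* Simplices that do not contain S contribute nothing. *)
have -> : (if S `<=` val s
     then \sum_(a : simplices W | val a == val s) weight W a * (submult S (val s))%:R
     else 0)
  = \sum_(a : simplices W | val a == val s) weight W a * (submult S (val s))%:R.
  case: ifPn => // nS; rewrite big1 // => a _.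
  by move: nS; rewrite -submult_eq0 => /eqP ->; rewrite mulr0.
apply: eq_big => [a|a /eqP -> //].
by rewrite -(inj_eq val_inj).
Qed.

(** Differences are taken between adding i and adding j, the operation dual to
    the pair {i} - {j}.  A function of the cardinality alone thus has degree
    zero. *)
Fixpoint deg_lt m g : Prop :=
  if m is m'.+1 then
    forall i j, deg_lt m' (fun a => g (i +` a) - g (j +` a))
  else g =1 (fun=> 0).

Lemma eq_deg_lt m g h : g =1 h -> deg_lt m g -> deg_lt m h.
Proof.
elim: m g h => [|m IH] g h gh /= hg; first by move=> a; rewrite -gh hg.
by move=> i j; apply: IH (hg i j) => a; rewrite !gh.
Qed.

Lemma deg_lt0 m : deg_lt m (fun=> 0).
Proof.
elim: m => [|m IH] //= i j.
by apply: eq_deg_lt IH => a; rewrite subr0.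
Qed.

Lemma deg_ltB m g h : deg_lt m g -> deg_lt m h -> deg_lt m (fun a => g a - h a).
Proof.
elim: m g h => [|m IH] g h /= hg hh; first by move=> a; rewrite hg hh subr0.
move=> i j; apply: eq_deg_lt (IH _ _ (hg i j) (hh i j)) => a.
by rewrite !opprD !opprK addrACA.
Qed.

(** In the difference of [submult S] at i +` a and j +` a the terms with S
    itself cancel, leaving counts of faces with one vertex less. *)
Lemma deg_lt_submult m S :
  (size S < m)%N -> deg_lt m (fun a => (submult S a)%:R).
Proof.
elim: m S => [|m IH] // S szS i j.
have hh k : deg_lt m (fun a => ((k \in S) * submult (S `\ k) a)%:R).
  case: (boolP (k \in S)) => kS; last first.
    by apply: eq_deg_lt (deg_lt0 m) => a; rewrite mul0n.
  apply: (@eq_deg_lt _ (fun a => (submult (S `\ k) a)%:R)) => [a|]; first by rewrite mul1n.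
  by apply: IH; move: szS; rewrite -{1}(msetB1K kS) size_msetD enum_msetn.
apply: eq_deg_lt (deg_ltB (hh i) (hh j)) => a.
by rewrite !submult_pascal !natrD opprD addrACA subrr add0r.
Qed.

(** Convolution with W lowers degrees by m.  Quantifying over r, instead of
    only asking that W kill functions of degree less than m, is what makes the
    property multiplicative ([lowers_deg_wprod]). *)
Definition lowers_deg m W := forall r g, deg_lt (r + m) g ->
  deg_lt r (fun a => wsum W (fun b => g (a `+` b))).

Lemma lowers_deg_wone : lowers_deg 0 wone.
Proof.
move=> r g; rewrite addn0; apply: eq_deg_lt => a.
by rewrite wsum_wone msetD0.
Qed.

Lemma lowers_deg_wpair i j : i != j -> lowers_deg 1 (wpair K i j).
Proof.
move=> ij r g; rewrite addn1 => /(_ i j); apply: eq_deg_lt => a.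
by rewrite wsum_wpair // ![a `+` _]msetDC.
Qed.

Lemma lowers_deg_wprod m1 m2 W1 W2 :
  lowers_deg m1 W1 -> lowers_deg m2 W2 -> lowers_deg (m1 + m2) (wprod W1 W2).
Proof.
move=> h1 h2 r g; rewrite addnA => /h2/h1; apply: eq_deg_lt => a.
rewrite wsum_wprod; apply: eq_wsum => b; apply: eq_wsum => c.
by rewrite msetDA.
Qed.

(** The case r = 0, evaluated at the empty multiset. *)
Lemma lowers_deg_face m W S : lowers_deg m W -> (size S < m)%N ->
  wsum W (fun a => (submult S a)%:R) = 0.
Proof.
move=> hW hS; have /(hW 0)/(_ mset0) <- := deg_lt_submult hS.
by apply: eq_wsum => a; rewrite mset0D.
Qed.

(** Modulo the simplices through v, the complex W is the single simplex s with
    weight e. *)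
Definition lead_term (v : 'I_n) W (e : K) s := forall g,
  (forall a, v \in a -> g a = 0) -> wsum W g = e * g s.

Lemma lead_term_wone v : lead_term v wone 1 mset0.
Proof. by move=> g _; rewrite wsum_wone mul1r. Qed.

Lemma lead_term_wpair v j : v != j -> lead_term v (wpair K v j) (-1) [mset j].
Proof.
by move=> vj g gv; rewrite wsum_wpair // gv ?mset11 // sub0r mulN1r.
Qed.

(** Simplices through v form an ideal for the multiset sum, so reduction
    modulo them is multiplicative. *)
Lemma lead_term_wprod v W1 W2 e1 e2 s1 s2 :
  lead_term v W1 e1 s1 -> lead_term v W2 e2 s2 ->
  lead_term v (wprod W1 W2) (e1 * e2) (s1 `+` s2).
Proof.
move=> h1 h2 g gv; rewrite wsum_wprod -mulrA.
rewrite -(h1 (fun a => e2 * g (a `+` s2))) => [|a va].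
  by apply: eq_wsum => a; rewrite h2 // => b vb; rewrite gv // in_msetD vb orbT.
by rewrite gv ?mulr0 // in_msetD va.
Qed.

End Pairing.

(** * Products of pairs through a common vertex *)

Section PairProducts.

Local Open Scope mset_scope.

Variables (K : fieldType) (n d : nat) (v : 'I_n).
Implicit Types (k : exponents d v) (s S : {mset 'I_n}).

Local Notation D := (complete_complex n d).

Lemma lowers_deg_pair_prod k :
  lowers_deg (\sum_j (k j : nat))%N (pair_prod K k).
Proof.
rewrite /pair_prod; elim/big_rec2: _ => [|j W m _ IH]; first exact: lowers_deg_wone.
apply: lowers_deg_wprod IH; rewrite /wpow.
case: (nat_of_ord (k j)) => [|r]; first exact: lowers_deg_wone.
have vj : v != val j by rewrite eq_sym (valP j).
rewrite iteropS; elim: r => /= [|r IH]; first exact: lowers_deg_wpair.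
by apply: (@lowers_deg_wprod _ _ 1%N) => //; apply: lowers_deg_wpair.
Qed.

Definition exponent_mset k : {mset 'I_n} :=
  \big[@msetD _/mset0]_j msetn (k j) (val j).

Lemma exponent_mset_val k j : exponent_mset k (val j) = k j.
Proof.
rewrite /exponent_mset.
rewrite (big_morph (fun s : {mset 'I_n} => s (val j)) (id1 := 0%N) (op1 := addn))
  => [|s t|]; rewrite ?msetE2 ?mset0E //.
rewrite (bigD1 j) //= msetnxx big1 ?addn0 // => i ij.
by rewrite msetnE (inj_eq val_inj) eq_sym (negPf ij).
Qed.

Lemma exponent_mset_apex k : exponent_mset k v = 0%N.
Proof.
rewrite /exponent_mset.
rewrite (big_morph (fun s : {mset 'I_n} => s v) (id1 := 0%N) (op1 := addn))
  => [|s t|]; rewrite ?msetE2 ?mset0E //.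
by rewrite big1 // => i _; rewrite msetnE eq_sym (negPf (valP i)).
Qed.

Lemma exponent_mset_inj : injective exponent_mset.
Proof.
move=> k l kl; apply/ffunP => j; apply: val_inj.
by rewrite /= -!exponent_mset_val kl.
Qed.

Lemma sum_apex_free s : s v = 0%N ->
  size s = (\sum_(j : {j : 'I_n | j != v}) s (val j))%N.
Proof.
move=> sv; rewrite size_msetE (bigD1 v) //= sv add0n.
rewrite (@reindex_omap _ _ _ _ {j : 'I_n | j != v} val insub) /=; last first.
  by move=> i iv; rewrite insubT.
by apply: eq_bigl => j; rewrite valK eqxx andbT (valP j).
Qed.

Lemma size_exponent_mset k : size (exponent_mset k) = (\sum_j (k j : nat))%N.
Proof.
rewrite sum_apex_free ?exponent_mset_apex //.
by apply: eq_bigr => j _; rewrite exponent_mset_val.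
Qed.

(** Each multiplicity is at most the cardinality d + 1, so it fits in the
    bounded range of exponents. *)
Lemma exponent_mset_surj s : size s = d.+1 -> s v = 0%N ->
  exists2 k : exponents d v, (\sum_j (k j : nat) == d.+1)%N & exponent_mset k = s.
Proof.
move=> szs sv.
have bnd j : (s j < d.+2)%N by rewrite ltnS -szs size_msetE (bigD1 j) //= leq_addr.
pose k : exponents d v := [ffun j => Ordinal (bnd (val j))].
have ks : exponent_mset k = s.
  apply/msetP => i; have [->|iv] := eqVneq i v; first by rewrite exponent_mset_apex.
  by rewrite -[i]/(val (Sub i iv : {j | j != v})) exponent_mset_val ffunE.
by exists k => //; rewrite -size_exponent_mset ks szs.
Qed.

Lemma lead_term_pair_prod k :
  lead_term v (pair_prod K k) ((-1) ^+ (\sum_j (k j : nat))%N) (exponent_mset k).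
Proof.
rewrite /pair_prod /exponent_mset.
elim/big_rec3: _ => [|j m s W _ IH]; first exact: lead_term_wone.
rewrite exprD; apply: lead_term_wprod IH; rewrite /wpow.
have vj : v != val j by rewrite eq_sym (valP j).
case: (nat_of_ord (k j)) => [|r]; first by rewrite msetn0; exact: lead_term_wone.
rewrite iteropS; elim: r => /= [|r IH]; first exact: lead_term_wpair.
have -> : msetn r.+2 (val j) = [mset val j] `+` msetn r.+1 (val j).
  by apply/msetP => i; rewrite msetE2 !msetnE; case: eqP.
by rewrite exprS; apply: lead_term_wprod IH; exact: lead_term_wpair.
Qed.

Lemma wfun_pair_prod k s : s v = 0%N ->
  wfun (pair_prod K k) s =
    if s == exponent_mset k then (-1) ^+ (\sum_j (k j : nat))%N else 0.
Proof.
move=> sv; rewrite wfun_wsum (@lead_term_pair_prod k) => [|a va].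
  by rewrite eq_sym; case: eqP; rewrite ?mulr1 ?mulr0.
by case: eqP => // as_; move: va; rewrite as_ in_mset sv.
Qed.

(** Evaluation at s, made total in s so that it is a functional for every
    multiset. *)
Definition coeff s (w : {ffun D -> K^o}) : K^o :=
  if insub s is Some t then w t else 0.

Lemma coeff_is_linear s : linear (coeff s).
Proof.
move=> a u w; rewrite /coeff; case: insub => [t|]; first by rewrite !ffunE.
by rewrite scaler0 addr0.
Qed.

HB.instance Definition _ s :=
  GRing.isLinear.Build K {ffun D -> K^o} K^o *:%R (coeff s) (coeff_is_linear s).

Lemma coeff_val (t : D) w : coeff (val t) w = w t.
Proof. by rewrite /coeff valK. Qed.

Lemma coeff_wext s W : size s = d.+1 -> coeff s (wext D W) = wfun W s.
Proof.
move=> szs; have sD : s \in D by rewrite multisetsP szs.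
by rewrite -[s]/(val [` sD]%fset) coeff_val ffunE.
Qed.

Lemma pair_prod_balancing_mem k : (\sum_j (k j : nat))%N = d.+1 ->
  pair_prod_balancing K k \in balancings K d D.
Proof.
move=> sk; apply/balancingsP => S szS.
rewrite face_sum_wext; last exact: pair_prod_sub.
by apply: (lowers_deg_face (@lowers_deg_pair_prod k)); rewrite sk ltnS.
Qed.

(** Induction on the multiplicity of v.  The faces of size d suffice: among
    the simplices containing s minus v, all but s itself have fewer copies of
    v than s. *)
Lemma balancing_eq0 (w : {ffun D -> K^o}) : [pchar K] =i pred0 ->
  is_balancing d w -> (forall s, s v = 0%N -> coeff s w = 0) -> w = 0.
Proof.
move=> charK bal w0.
suff h m s : (s v <= m)%N -> coeff s w = 0.
  by apply/ffunP => t; rewrite ffunE -coeff_val (h _ _ (leqnn _)).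
elim: m s => [|m IH] s hs; first by apply: w0; apply/eqP; rewrite -leqn0.
have [sm|sm] := leqP (s v) m; first exact: IH.
have [sD|nsD] := boolP (s \in D); last by rewrite /coeff insubF // (negPf nsD).
have szD (t : {mset 'I_n}) : t \in D -> size t = d.+1.
  by rewrite multisetsP => /eqP.
have vs : v \in s by rewrite in_mset (leq_trans _ sm).
have szS : size (s `\ v) = d.
  by apply: succn_inj; rewrite -(szD s sD) -[in RHS](msetB1K vs) size_msetD enum_msetn.
have Ss : s `\ v `<=` s by exact: msubD1set.
have := bal (s `\ v); rewrite szS leqnn => /(_ isT).
rewrite /face_sum (bigD1 [` sD]%fset) //= big1 ?addr0 => [/eqP|t /andP[St ts]].
  rewrite -(coeff_val [` sD]%fset) /= mulf_eq0 => /orP[/eqP //|].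
  by rewrite ((pcharf0P _).1 charK) submult_eq0 Ss.
(* If t had as many copies of v as s, it would contain s, hence equal it. *)
rewrite -coeff_val; have tD : val t \in D := fsvalP t.
have [tm|tm] := leqP ((val t : {mset 'I_n}) v) m; first by rewrite IH // mul0r.
case/eqP: ts; apply: val_inj; apply/esym/msubset_size_eq; last by rewrite !szD.
apply/msubsetP => i; have /msubsetP/(_ i) := St; rewrite msetB1E.
by have [->|] := eqVneq i v; rewrite ?subn0 // => _; apply: leq_trans hs tm.
Qed.

End PairProducts.

Theorem proposition5p4 (K : fieldType) (hK : [pchar K] =i pred0)
    (n d : nat) (hn : (0 < n)%N) :
  basis_of (balancings K d (complete_complex n d))
    (product_balancings K d (Ordinal hn)).
Proof.
set v := Ordinal hn; rewrite /product_balancings.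
apply: (basis_of_dual (c := (-1) ^+ d.+1)
  (phi := fun k : exponents d v => coeff (exponent_mset k))).
- by rewrite signr_eq0.
- by rewrite filter_uniq // enum_uniq.
- move=> k l; rewrite !mem_filter => /andP[/eqP sk _] /andP[/eqP sl _].
  rewrite /= coeff_wext ?size_exponent_mset // wfun_pair_prod ?exponent_mset_apex //.
  by rewrite (inj_eq (@exponent_mset_inj _ _ _)) sl.
- move=> k; rewrite mem_filter => /andP[/eqP sk _]; exact: pair_prod_balancing_mem.
move=> w /balancingsP bal w0; apply: (balancing_eq0 (v := v) hK bal) => s sv.
have [szs|szs] := eqVneq (size s) d.+1.
  have [k sk <-] := exponent_mset_surj szs sv.
  by apply: w0; rewrite mem_filter sk mem_enum.
by rewrite /coeff insubF // multisetsP (negPf szs).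
Qed.
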